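(* Let $f$ be symmetric about $0$, monotonically decreasing on $[0,\infty)$, positive on $\mathbb{R}$ and continuous. Let $\mathbf{x}_n=(x_1,\dots,x_n)\in\mathbb{R}^n$, $s\in\mathbb{N}$, $b>0$, and let $\xi=\xi_{n,s}=(s,a_1,\dots,a_s,\sigma_1,\dots,\sigma_s,\pi_0,\pi_1,\dots,\pi_s)$ be a global maximizer, under the restriction $\sigma_j\ge\sigma_0$, of $$L_{n,s}(\xi,\mathbf{x}_n)=\sum_{i=1}^n\log\Big(\sum_{j=1}^s\pi_jf_{a_j,\sigma_j}(x_i)+\pi_0b\Big).$$ Write $L_{n,r}=L_{n,r}(\xi_{n,r},\mathbf{x}_n)$ for the maximal value with $r$ components, $\theta_j=(a_j,\sigma_j)$, and assume $f_{\max}:=f(0)/\sigma_0>b$. Let $g\in\mathbb{N}$. If $$\max_{r<s}L_{n,r}<\sum_{i=1}^n\log\Big(\sum_{j=1}^s\pi_jf_{\theta_j}(x_i)+\Big(\pi_0+\frac gn\Big)b\Big)+g\log\Big[\Big(\pi_0+\frac gn\Big)b\Big]+(n+g)\log\frac{n}{n+g}-g\log f_{\max},$$ then $$B_{1,n}(\xi_{n,s},\mathbf{x}_n)>\frac{g}{n+g}.$$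
   Context: $f$ is a probability density on $\mathbb{R}$ and $f_{a,\sigma}(x)=\frac1\sigma f\big(\frac{x-a}{\sigma}\big)$ for $a\in\mathbb{R}$, $\sigma>0$; $f_{\theta}=f_{a,\sigma}$ for $\theta=(a,\sigma)$. The parameters satisfy $a_j\in\mathbb{R}$, $\pi_0,\dots,\pi_s\ge0$, $\sum_{j=0}^s\pi_j=1$, $\sigma_j\ge\sigma_0$ for $j=1,\dots,s$, where $\sigma_0>0$ and $b>0$ are constants fixed in advance (independent of $n$ and the data); $b$ is the value of an improper uniform ''noise'' density on the whole real line. The maximum over $r<s$ is over nonnegative integers $r$, where $L_{n,0}=n\log b$ corresponds to the noise component alone. Maximizers need not be unique; the result holds for any choice of global maximizer for each dataset and sample size, defining a sequence of estimators $E_n(\mathbf{x}_n)=\xi_{n,s}$ for fixed $s$. Breakdown point: let $\mathbf{x}_n$ be a dataset for which $\hat\xi=E_n(\mathbf{x}_n)$ has $\hat\pi_j>0$ for $j=1,\dots,s$ (this is part of the definition of the breakdown point). With $\mathbb{R}^+=(0,\infty)$, the one-component parameter breakdown point $B_{1,n}(E_n,\mathbf{x}_n)$ is the minimum of $\frac{g}{n+g}$ over all $g\in\mathbb{N}$ such that: there exists $j\in\{1,\dots,s\}$ such that for every set $D=[\pi_{\min},1]\times C$ with $\pi_{\min}>0$ and $C\subset\mathbb{R}\times\mathbb{R}^+$ compact there is a dataset $\mathbf{x}_{n+g}=(x_1,\dots,x_n,x_{n+1},\dots,x_{n+g})$ extending $\mathbf{x}_n$ by $g$ real points, for which $\hat\xi=E_{n+g}(\mathbf{x}_{n+g})$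 satisfies $(\hat\pi_j,\hat a_j,\hat\sigma_j)\notin D$. (Minimum over the empty set is read as $+\infty$.) *)

(* Defs.v *)
From mathcomp Require Import all_boot all_order all_algebra.
From mathcomp Require Import all_classical all_reals all_analysis.
Import Order.TTheory GRing.Theory Num.Theory.
Import numFieldNormedType.Exports.

Set Implicit Arguments.
Unset Strict Implicit.
Unset Printing Implicit Defensive.

Local Open Scope classical_set_scope.
Local Open Scope ring_scope.

Definition is_density (R : realType) (f : R -> R) : Prop :=
  [/\ measurable_fun setT f,
      forall x, 0 <= f x
    & (\int[lebesgue_measure]_x (f x)%:E = 1)%E].

Definition locscale (R : realType) (f : R -> R) (a sigma x : R) : R :=
  sigma^-1 * f ((x - a) / sigma).

(* The components 1, ..., s are indexed by 'I_s; the weight pi_0 of the noise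
   component is the separate field [noise]. *)
Record mixpar (R : realType) (s : nat) := MixPar {
  loc : 'I_s -> R;
  scale : 'I_s -> R;
  weight : 'I_s -> R;
  noise : R
}.

Definition admissible (R : realType) (sigma0 : R) (s : nat)
    (xi : mixpar R s) : Prop :=
  [/\ forall j, sigma0 <= scale xi j,
      forall j, 0 <= weight xi j,
      0 <= noise xi
    & noise xi + \sum_(j < s) weight xi j = 1].

Definition mixdens (R : realType) (f : R -> R) (s : nat) (xi : mixpar R s)
    (x : R) : R :=
  \sum_(j < s) weight xi j * locscale f (loc xi j) (scale xi j) x.

Definition loglik (R : realType) (f : R -> R) (b : R) (s n : nat)
    (xi : mixpar R s) (x : n.-tuple R) : R :=
  \sum_(i < n) ln (mixdens f xi (tnth x i) + noise xi * b).

Definition is_maximizer (R : realType) (f : R -> R) (b sigma0 : R) (s n : nat)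
    (x : n.-tuple R) (xi : mixpar R s) : Prop :=
  admissible sigma0 xi /\
  forall xi' : mixpar R s,
    admissible sigma0 xi' -> loglik f b xi' x <= loglik f b xi x.

Definition breaks_down (R : realType) (s : nat)
    (E : forall m : nat, m.-tuple R -> mixpar R s) (n : nat)
    (x : n.-tuple R) (g : nat) : Prop :=
  exists j : 'I_s,
    forall (pmin : R) (C : set (R * R)),
      0 < pmin -> compact C -> C `<=` [set t | 0 < t.2] ->
      exists y : g.-tuple R,
        let xi := E (n + g)%N [tuple of x ++ y] in
        ~ (`[pmin, 1]%classic `*` C) (weight xi j, (loc xi j, scale xi j)).

(* For n > 0, g / (n + g) increases with g, so the infimum over a nonempty set
   of values is attained; over the empty set it is +oo.  If E selects
   admissible parameters with positive weights at x (and sigma0 > 0), g = 0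
   never belongs to the set. *)
Definition breakdown_point (R : realType) (s : nat)
    (E : forall m : nat, m.-tuple R -> mixpar R s) (n : nat)
    (x : n.-tuple R) : \bar R :=
  ereal_inf [set (g%:R / (n + g)%:R)%:E | g in [set g | breaks_down E x g]].

(* Main.v *)
(* Mixing a noise share g / (n + g) into the maximizer at x bounds from below the
   maximal log-likelihood after adding any k <= g points.  An added point
   contributes at most ln fmax, so the points of x alone contribute at least the
   right-hand side T of the hypothesis.  This keeps the mixture density at the
   points of x bounded away from 0, uniformly in the added points.  A component
   whose parameters leave a large enough compact set has negligible density at
   the points of x; transferring its weight to the noise gives a mixture with
   s - 1 components and log-likelihood arbitrarily close to T at x, which
   contradicts L_(s-1) < T. *)

Require Import Defs.
From mathcomp Require Import all_boot all_order all_algebra.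
From mathcomp Require Import all_classical all_reals all_analysis.
From mathcomp Require Import measurable_realfun ring lra.
Import Order.TTheory GRing.Theory Num.Theory.
Import numFieldNormedType.Exports.

Local Open Scope classical_set_scope.
Local Open Scope ring_scope.

Section Mixture.
Context (R : realType) (f : R -> R) (b sigma0 : R).
Context (f_density : is_density f)
  (f_sym : forall t, f (- t) = f t)
  (f_decr : forall t u : R, 0 <= t -> t <= u -> f u <= f t)
  (f_pos : forall t, 0 < f t)
  (b_gt0 : 0 < b) (sigma0_gt0 : 0 < sigma0) (b_lt : b < f 0 / sigma0).

Let fmax := f 0 / sigma0.

(** * Bounds on the density and its location-scale family *)

Lemma fmax_gt0 : 0 < fmax.
Proof. exact: divr_gt0. Qed.

Lemma unimodal_le t u : `|t| <= `|u| -> f u <= f t.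
Proof.
have f_norm v : f v = f `|v|.
  by case: (ger0P v) => _; rewrite ?f_sym.
by move=> tu; rewrite (f_norm t) (f_norm u); exact: f_decr.
Qed.

(** The mass of [f] on [[0, r]] is at least [r * f r] by monotonicity and at most 1. This explicit
    tail decay handles components whose location escapes. *)
Lemma unimodal_density_le_inv r : 0 < r -> f r <= r^-1.
Proof.
move=> r_gt0; case: f_density => f_meas f_ge0 f_int.
rewrite -[leRHS]mul1r ler_pdivlMr// -lee_fin.
rewrite -f_int; move/measurable_EFinP: (f_meas) => fE_meas.
apply: (@le_trans _ _ (\int[lebesgue_measure]_(t in `[0%R, r]) (f t)%:E)%E).
  have -> : (f r * r)%:E = (\int[lebesgue_measure]_(t in `[0%R, r]) (cst (f r)%:E t))%E.
    rewrite integral_cst//= lebesgue_measure_itv/= lte_fin r_gt0.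
    by rewrite -EFinB subr0 -EFinM.
  apply: ge0_le_integral => //.
  - by move=> t _; rewrite lee_fin ltW.
  - exact: measurable_funS fE_meas.
  - by move=> t; rewrite /= in_itv/= lee_fin => /andP[t0 tr]; exact: f_decr.
by apply: ge0_subset_integral => // t _; rewrite lee_fin.
Qed.

Lemma locscale_ge0 a sigma t : sigma0 <= sigma -> 0 <= locscale f a sigma t.
Proof.
move=> sigma_ge; rewrite mulr_ge0 ?(ltW (f_pos _))// invr_ge0.
exact: le_trans (ltW sigma0_gt0) sigma_ge.
Qed.

Lemma locscale_le_peak a sigma t :
  sigma0 <= sigma -> locscale f a sigma t <= f 0 / sigma.
Proof.
move=> sigma_ge; rewrite /locscale mulrC ler_wpM2r//.
  by rewrite invr_ge0 (le_trans (ltW sigma0_gt0)).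
by apply: unimodal_le; rewrite normr0.
Qed.

Lemma locscale_le_fmax a sigma t : sigma0 <= sigma -> locscale f a sigma t <= fmax.
Proof.
move=> sigma_ge; apply: (le_trans (locscale_le_peak _ _ _ sigma_ge)).
rewrite ler_wpM2l ?(ltW (f_pos _))// lef_pV2// posrE.
exact: lt_le_trans sigma0_gt0 sigma_ge.
Qed.

(** * Mixture densities and log-likelihoods *)

Let mixture s (xi : mixpar R s) t := mixdens f xi t + noise xi * b.

Lemma mixdens_ge0 s (xi : mixpar R s) t : admissible sigma0 xi -> 0 <= mixdens f xi t.
Proof.
by case=> sc w_ge0 _ _; apply: sumr_ge0 => j _; rewrite mulr_ge0 ?locscale_ge0.
Qed.

(** If the noise weight vanishes, the other weights sum to 1 and [f] is positive, so some component
    contributes. Positivity matters because [ln] is 0 at nonpositive arguments. *)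
Lemma mixture_gt0 s (xi : mixpar R s) t : admissible sigma0 xi -> 0 < mixture s xi t.
Proof.
move=> adm; have := adm; case=> sc w_ge0 noise_ge0 sum1; rewrite /mixture.
have [noise_gt0|] := ltP 0 (noise xi).
  by rewrite ltr_wpDl ?mixdens_ge0// mulr_gt0.
move=> noise_le0; have noise0 : noise xi = 0.
  by apply/eqP; rewrite eq_le noise_le0.
rewrite noise0 mul0r addr0 lt_neqAle mixdens_ge0// andbT eq_sym.
apply/negP => /eqP; rewrite /mixdens => /psumr_eq0P eq0.
have : noise xi + \sum_(j < s) weight xi j = 0.
  rewrite noise0 add0r; apply: big1 => j _.
  have /eqP := eq0 (fun k _ => mulr_ge0 (w_ge0 k) (locscale_ge0 _ _ _ (sc k))) j isT.
  rewrite mulf_eq0 => /orP[/eqP//|].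
  rewrite gt_eqF// mulr_gt0// invr_gt0.
  exact: lt_le_trans sigma0_gt0 (sc j).
by rewrite sum1 => /eqP; rewrite oner_eq0.
Qed.

Lemma mixture_le_fmax s (xi : mixpar R s) t :
  admissible sigma0 xi -> mixture s xi t <= fmax.
Proof.
case=> sc w_ge0 noise_ge0 sum1; rewrite /mixture -[leRHS]mul1r -sum1 mulrDl addrC.
rewrite lerD ?ler_wpM2l ?(ltW b_lt)// mulr_suml.
by apply: ler_sum => j _; rewrite ler_wpM2l ?locscale_le_fmax.
Qed.

Lemma loglik_cat s m k (xi : mixpar R s) (x : m.-tuple R) (y : k.-tuple R) :
  loglik f b xi [tuple of x ++ y] = loglik f b xi x + loglik f b xi y.
Proof.
rewrite /loglik big_split_ord/=; congr (_ + _); apply: eq_bigr => i _.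
  by rewrite tnth_lshift.
by rewrite tnth_rshift.
Qed.

Lemma loglik_le_fmax s m (xi : mixpar R s) (x : m.-tuple R) :
  admissible sigma0 xi -> loglik f b xi x <= m%:R * ln fmax.
Proof.
move=> adm; apply: (@le_trans _ _ (\sum_(i < m) ln fmax)).
  apply: ler_sum => i _.
  by rewrite ler_ln ?posrE ?fmax_gt0 ?mixture_gt0 ?mixture_le_fmax.
by rewrite sumr_const card_ord mulr_natl.
Qed.

(* All other terms of the log-likelihood are at most [ln fmax]. *)
Lemma mixture_ge_of_loglik s m (xi : mixpar R s) (x : m.-tuple R) (T : R) i :
  admissible sigma0 xi -> T <= loglik f b xi x ->
  expR (T - m%:R * ln fmax) * fmax <= mixture s xi (tnth x i).
Proof.
move=> adm T_le; rewrite -[X in _ * X]lnK ?posrE ?fmax_gt0// -expRD.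
rewrite -[leRHS]lnK ?posrE ?mixture_gt0// ler_expR.
have gap_ge0 k : 0 <= ln fmax - ln (mixture s xi (tnth x k)).
  by rewrite subr_ge0 ler_ln ?posrE ?fmax_gt0 ?mixture_gt0 ?mixture_le_fmax.
have : ln fmax - ln (mixture s xi (tnth x i)) <= m%:R * ln fmax - T.
  apply: (@le_trans _ _ (\sum_(k < m) (ln fmax - ln (mixture s xi (tnth x k))))).
    by rewrite (bigD1 i)//= lerDl sumr_ge0.
  rewrite sumrB sumr_const card_ord -[ln fmax *+ m]mulr_natl lerD2l lerN2.
  exact: T_le.
lra.
Qed.

(** * Adding noise and removing a component *)

Definition add_noise (t : R) {s} (xi : mixpar R s) : mixpar R s :=
  MixPar (loc xi) (scale xi) (fun j => (1 - t) * weight xi j)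
    ((1 - t) * noise xi + t).

Lemma admissible_add_noise t s (xi : mixpar R s) :
  0 <= t <= 1 -> admissible sigma0 xi -> admissible sigma0 (add_noise t xi).
Proof.
move=> /andP[t_ge0 t_le1] [sc w_ge0 noise_ge0 sum1]; split => //=.
- by move=> j; rewrite mulr_ge0 ?subr_ge0.
- by rewrite addr_ge0// mulr_ge0 ?subr_ge0.
- by rewrite -mulr_sumr addrAC -mulrDr sum1; ring.
Qed.

Lemma mixdens_add_noise t s (xi : mixpar R s) u :
  mixdens f (add_noise t xi) u = (1 - t) * mixdens f xi u.
Proof.
by rewrite /mixdens mulr_sumr; apply: eq_bigr => j _; rewrite /= -mulrA.
Qed.

(** The freed weight goes to the noise instead of being spread by renormalization, so the remaining
    component terms are unchanged. *)
Definition drop_component {s} (xi : mixpar R s.+1) (j : 'I_s.+1) : mixpar R s :=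
  MixPar (fun k => loc xi (lift j k)) (fun k => scale xi (lift j k))
    (fun k => weight xi (lift j k)) (noise xi + weight xi j).

Lemma admissible_drop_component s (xi : mixpar R s.+1) j :
  admissible sigma0 xi -> admissible sigma0 (drop_component xi j).
Proof.
case=> sc w_ge0 noise_ge0 sum1; split => //=; first by rewrite addr_ge0.
by rewrite -sum1 [in RHS](bigD1_ord j)//= addrA.
Qed.

Lemma mixture_drop_component s (xi : mixpar R s.+1) j t :
  0 <= weight xi j ->
  mixture s.+1 xi t - weight xi j * locscale f (loc xi j) (scale xi j) t <=
    mixture s (drop_component xi j) t.
Proof.
move=> w_ge0; rewrite /mixture /mixdens (bigD1_ord j)//=.
have := mulr_ge0 w_ge0 (ltW b_gt0).
by rewrite [(_ + weight xi j) * b]mulrDl; lra.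
Qed.

(** Each mixture value at the data shrinks at worst by the factor [1 - rho], so each logarithm loses
    at most [- ln (1 - rho)]. *)
Lemma loglik_drop_component s m (xi : mixpar R s.+1) j (x : m.-tuple R) (rho : R) :
  admissible sigma0 xi -> rho < 1 ->
  (forall i, weight xi j * locscale f (loc xi j) (scale xi j) (tnth x i) <=
     rho * mixture s.+1 xi (tnth x i)) ->
  loglik f b xi x + m%:R * ln (1 - rho) <= loglik f b (drop_component xi j) x.
Proof.
move=> adm rho_lt1 small.
rewrite mulr_natl -[m in _ *+ m]card_ord -sumr_const -big_split/=.
apply: ler_sum => i _.
have mix_gt0 := mixture_gt0 _ _ (tnth x i) adm.
rewrite -lnM ?posrE ?subr_gt0// ler_ln ?posrE ?mulr_gt0 ?subr_gt0//; last first.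
  exact: mixture_gt0 (admissible_drop_component _ _ _ adm).
case: adm => _ /(_ j) w_ge0 _ _.
apply: le_trans (mixture_drop_component _ _ _ _ w_ge0).
have := small i; rewrite /mixture; lra.
Qed.

(** * Escaping components and the exclusion of breakdown *)

(** A triple leaves the box through a small weight, a large scale, or a distant location with
    bounded scale. The bound [fmax], the peak [f 0 / sigma] and the tail bound treat these cases in
    turn. *)
Lemma component_small_off_compact m (x : m.-tuple R) (eta : R) : 0 < eta ->
  exists (pmin : R) (C : set (R * R)),
    [/\ 0 < pmin, compact C, C `<=` [set t | 0 < t.2] &
      forall w a sigma, 0 <= w <= 1 -> sigma0 <= sigma ->
        ~ (`[pmin, 1]%classic `*` C) (w, (a, sigma)) ->
        forall i, w * locscale f a sigma (tnth x i) <= eta].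
Proof.
move=> eta_gt0.
(* A scale above [K] has peak below [eta]. For a scale at most [K] and a location beyond [M], every
   standardized data point has absolute value at least [(eta * sigma0)^-1]. *)
pose K := f 0 / eta; pose B := \sum_(i < m) `|tnth x i|.
pose M := B + K / (eta * sigma0).
have K_gt0 : 0 < K by rewrite divr_gt0.
have es_gt0 : 0 < eta * sigma0 by rewrite mulr_gt0.
exists (eta / fmax), (`[- M, M] `*` `[sigma0, K]); split.
- by rewrite divr_gt0 ?fmax_gt0.
- by apply: compact_setX; exact: segment_compact.
- by move=> [a sigma] [_] /=; rewrite in_itv/= => /andP[]/(lt_le_trans sigma0_gt0).
move=> w a sigma /andP[w_ge0 w_le1] sigma_ge notin i.
have sigma_gt0 : 0 < sigma by exact: lt_le_trans sigma_ge.
have small_locscale : locscale f a sigma (tnth x i) <= eta ->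
    w * locscale f a sigma (tnth x i) <= eta.
  by apply: le_trans; rewrite ler_piMl// locscale_ge0.
have [w_lt|w_ge] := ltP w (eta / fmax).
  apply: (@le_trans _ _ (w * fmax)); first by rewrite ler_wpM2l ?locscale_le_fmax.
  by rewrite -ler_pdivlMr ?fmax_gt0// ltW.
apply: small_locscale.
have [sigma_gt|sigma_le] := ltP K sigma.
  apply: (le_trans (locscale_le_peak _ _ _ sigma_ge)).
  by rewrite ler_pdivrMr// mulrC -ler_pdivrMr// ltW.
have [a_le|a_gt] := leP `|a| M.
  exfalso; apply: notin; split => /=; first by rewrite in_itv/= w_ge.
  by split; rewrite /= in_itv/= -?ler_norml// sigma_ge.
have r_gt0 : 0 < (eta * sigma0)^-1 by rewrite invr_gt0.
apply: (@le_trans _ _ (sigma^-1 * (eta * sigma0))); last first.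
  by rewrite mulrC ler_pdivrMr// ler_wpM2l// ltW.
rewrite ler_wpM2l ?invr_ge0 ?(ltW sigma_gt0)//.
rewrite -[leRHS]invrK; apply: le_trans (unimodal_density_le_inv _ r_gt0).
apply: unimodal_le; rewrite (gtr0_norm r_gt0) normrM normfV (gtr0_norm sigma_gt0).
rewrite ler_pdivlMr//.
have x_le : `|tnth x i| <= B by rewrite /B (bigD1 i)//= lerDl sumr_ge0.
have : (eta * sigma0)^-1 * sigma <= K / (eta * sigma0).
  by rewrite mulrC ler_wpM2r// ltW.
have := lerB_dist a (tnth x i); rewrite distrC /M in a_gt *; lra.
Qed.

(* The noise share [g / (n + g)] does not depend on [k], so that one bound covers
   every [k <= g]. *)
Lemma loglik_maximizer_cat_ge s n g k (xi xi' : mixpar R s) (x : n.-tuple R)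
    (y : k.-tuple R) :
  (0 < n)%N -> (k <= g)%N -> admissible sigma0 xi ->
  is_maximizer f b sigma0 [tuple of x ++ y] xi' ->
  \sum_(i < n) ln (mixdens f xi (tnth x i) + (noise xi + g%:R / n%:R) * b)
    + g%:R * ln ((noise xi + g%:R / n%:R) * b)
    + (n + g)%:R * ln (n%:R / (n + g)%:R) - g%:R * ln fmax
    + k%:R * ln fmax <= loglik f b xi' [tuple of x ++ y].
Proof.
move=> n_gt0 k_le adm [_ max]; pose t : R := g%:R / (n + g)%:R.
have nR_gt0 : 0 < n%:R :> R by rewrite ltr0n.
have ngR_gt0 : 0 < (n + g)%:R :> R by rewrite ltr0n addn_gt0 n_gt0.
have gR_ge0 : 0 <= g%:R :> R by rewrite ler0n.
have t01 : 0 <= t <= 1.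
  by rewrite /t divr_ge0 ?ler0n//= ler_pdivrMr// mul1r ler_nat leq_addl.
have subt : 1 - t = n%:R / (n + g)%:R.
  by apply/eqP; rewrite /t subr_eq -mulrDl -natrD divff// gt_eqF.
(* By this identity the noise weight after mixing is [(1 - t) * q], so that [1 - t] factors out of
   every mixture value. *)
have subtM : (1 - t) * (g%:R / n%:R) = t.
  by rewrite subt /t; field; rewrite -natrD !gt_eqF.
have subt_gt0 : 0 < 1 - t by rewrite subt divr_gt0.
apply: le_trans (max _ (admissible_add_noise _ _ _ t01 adm)).
rewrite loglik_cat -subt.
set q := noise xi + g%:R / n%:R.
have mixE u : mixture s (add_noise t xi) u = (1 - t) * (mixdens f xi u + q * b).
  rewrite /mixture mixdens_add_noise /= mulrDr; congr (_ + _).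
  by rewrite mulrA /q mulrDr subtM.
have x_eq : loglik f b (add_noise t xi) x =
    \sum_(i < n) ln (mixdens f xi (tnth x i) + q * b) + n%:R * ln (1 - t).
  rewrite mulr_natl -[n in _ *+ n]card_ord -sumr_const -big_split/=.
  apply: eq_bigr => i _; rewrite [X in ln X]mixE lnM ?posrE//; first exact: addrC.
  rewrite /q mulrDl addrA ltr_wpDr ?mixture_gt0//.
  by rewrite mulr_ge0 ?(ltW b_gt0)// divr_ge0.
(* As [(1 - t) * q * b] is at most [fmax], the first claim accounts for the [g - k] points not
   added. For the second, the noise alone bounds the density at each added point. *)
have [u_le y_ge] : 0 <= (g%:R - k%:R) * (ln fmax - (ln (1 - t) + ln (q * b))) /\
    k%:R * (ln (1 - t) + ln (q * b)) <= loglik f b (add_noise t xi) y.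
  have [g0|g_gt0] := posnP g.
    move: k_le; rewrite [in (_ <= g)%N]g0 leqn0 => /eqP k0; subst k; rewrite g0.
    by rewrite subrr !mul0r /loglik big_ord0.
  have q_gt0 : 0 < q.
    rewrite ltr_wpDl ?divr_gt0 ?ltr0n//.
    by case: adm.
  have qb_gt0 : 0 < q * b by rewrite mulr_gt0.
  have qt_le1 : (1 - t) * q <= 1.
    have noise_le1 : noise xi <= 1.
      by case: adm => _ w_ge0 _ <-; rewrite lerDl sumr_ge0.
    rewrite /q mulrDr subtM -lerBrDr -[leRHS]mulr1 ler_wpM2l//; exact: ltW.
  rewrite -lnM ?posrE//; split.
    rewrite mulr_ge0 ?subr_ge0 ?ler_nat// ler_ln ?posrE ?fmax_gt0 ?mulr_gt0// mulrA.
    apply: le_trans (ltW b_lt); rewrite -[leRHS]mul1r ler_wpM2r//; exact: ltW.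
  rewrite mulr_natl -[k in _ *+ k]card_ord -sumr_const.
  apply: ler_sum => i _; rewrite [X in _ <= ln X]mixE.
  have qb_le u : q * b <= mixdens f xi u + q * b by rewrite lerDr mixdens_ge0.
  have D_gt0 u := lt_le_trans qb_gt0 (qb_le u).
  by rewrite ler_ln ?posrE ?mulr_gt0// ler_wpM2l ?qb_le// ltW.
rewrite x_eq natrD; move: u_le y_ge; lra.
Qed.

Lemma not_breaks_down s n k (x : n.-tuple R) (xi : mixpar R s) (T : R)
    (E : forall m : nat, m.-tuple R -> mixpar R s.+1) :
  (0 < n)%N -> is_maximizer f b sigma0 x xi -> loglik f b xi x < T ->
  (forall m (y : m.-tuple R), admissible sigma0 (E m y)) ->
  (forall y : k.-tuple R, T + k%:R * ln fmax <=
     loglik f b (E (n + k)%N [tuple of x ++ y]) [tuple of x ++ y]) ->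
  ~ breaks_down E x k.
Proof.
move=> n_gt0 [_ max] ltT adm T_le [j].
have nR_gt0 : 0 < n%:R :> R by rewrite ltr0n.
(* Dropping a component will cost at most [n * d], half of the gap, so the result still exceeds the
   maximum attained by [xi]. *)
pose d := (T - loglik f b xi x) / (2 * n%:R).
have d_gt0 : 0 < d by rewrite divr_gt0 ?subr_gt0// mulr_gt0.
pose rho := 1 - expR (- d); pose c := expR (T - n%:R * ln fmax) * fmax.
have rho_gt0 : 0 < rho by rewrite subr_gt0 expR_lt1 oppr_lt0.
have rho_lt1 : rho < 1 by rewrite ltrBlDr ltrDl expR_gt0.
have c_gt0 : 0 < c by rewrite mulr_gt0 ?expR_gt0 ?fmax_gt0.
(* The threshold [rho * c] is independent of [y], as it must be: the compact set is chosen before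
   the added points. *)
have [pmin [C [pmin_gt0 Cc Cpos small]]] :=
  component_small_off_compact _ x _ (mulr_gt0 rho_gt0 c_gt0).
move=> /(_ pmin C pmin_gt0 Cc Cpos) [y] /=.
set xi' := E _ _ => notin.
have adm' : admissible sigma0 xi' by exact: adm.
have loglik_ge : T <= loglik f b xi' x.
  have := T_le y; rewrite -/xi' loglik_cat.
  by have := loglik_le_fmax _ _ _ y adm'; lra.
have w01 : 0 <= weight xi' j <= 1.
  case: adm' => _ w_ge0 noise_ge0 <-; rewrite w_ge0/= (bigD1 j)//= addrCA lerDl.
  by rewrite addr_ge0// sumr_ge0.
have sc : sigma0 <= scale xi' j by case: adm'.
have := max _ (admissible_drop_component _ _ j adm').
suff : loglik f b xi' x + n%:R * ln (1 - rho) <=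
    loglik f b (drop_component xi' j) x.
  have -> : n%:R * ln (1 - rho) = - ((T - loglik f b xi x) / 2).
    by rewrite /rho subKr expRK /d; field; rewrite gt_eqF.
  lra.
apply: loglik_drop_component => // i.
apply: le_trans (small _ _ _ w01 sc notin i) _.
by rewrite ler_wpM2l ?(ltW rho_gt0)//; exact: mixture_ge_of_loglik.
Qed.

End Mixture.

Theorem theorem4p11 (R : realType) (f : R -> R) (b sigma0 : R)
    (s n g : nat) (x : n.-tuple R)
    (E : forall m : nat, m.-tuple R -> mixpar R s)
    (xi_ : forall r : nat, mixpar R r)
    (f_density : is_density f)
    (f_sym : forall t, f (- t) = f t)
    (f_decr : forall t u, 0 <= t -> t <= u -> f u <= f t)
    (f_pos : forall t, 0 < f t)
    (f_cont : continuous f)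
    (s_gt0 : (0 < s)%N) (n_gt0 : (0 < n)%N)
    (b_gt0 : 0 < b) (sigma0_gt0 : 0 < sigma0)
    (E_max : forall (m : nat) (y : m.-tuple R),
       is_maximizer f b sigma0 y (E m y))
    (xi_max : forall r : nat, (r < s)%N -> is_maximizer f b sigma0 x (xi_ r))
    (E_pos : forall j : 'I_s, 0 < weight (E n x) j) :
  let xi := E n x in
  let fmax := f 0 / sigma0 in
  let L r := loglik f b (xi_ r) x in
  b < fmax ->
  \big[Num.max/L 0%N]_(r < s) L r <
    \sum_(i < n) ln (mixdens f xi (tnth x i) + (noise xi + g%:R / n%:R) * b)
    + g%:R * ln ((noise xi + g%:R / n%:R) * b)
    + (n + g)%:R * ln (n%:R / (n + g)%:R)
    - g%:R * ln fmax ->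
  ((g%:R / (n + g)%:R)%:E < breakdown_point E x)%E.
Proof.
move=> xi fmax L b_lt L_lt.
(* The breakdown point is an infimum over all numbers of added points, so every [k <= g] has to be
   excluded. *)
have noBD k : (k <= g)%N -> ~ breaks_down E x k.
  move=> k_le; case: s s_gt0 E xi_max E_max E_pos @xi L_lt => // s' _ E' xi_max' E_max' _ xi L_lt.
  apply: (not_breaks_down _ _ _ _ f_density f_sym f_decr f_pos b_gt0 sigma0_gt0 b_lt
    _ _ _ _ (xi_ s') _ _ n_gt0 (xi_max' _ (ltnSn s'))).
  - by apply: le_lt_trans L_lt; apply: (bigmax_sup ord_max).
  - by move=> m y; case: (E_max' m y).
  - move=> y; apply: loglik_maximizer_cat_ge => //.
    by case: (E_max' n x).
have ng_gt0 m : 0 < (n + m)%:R :> R by rewrite ltr0n addn_gt0 n_gt0.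
(* An infimum need not preserve strictness; the value at [g + 1] is a lower bound strictly above the
   value at [g]. *)
apply: (@lt_le_trans _ _ (g.+1%:R / (n + g.+1)%:R)%:E).
  rewrite lte_fin ltr_pdivrMr// mulrAC ltr_pdivlMr// -!natrM ltr_nat.
  by rewrite !mulnDr (mulnC g.+1 g) ltn_add2r ltn_pmul2r.
apply: le_ereal_inf_tmp => _ [k BDk <-].
have g_lt : (g < k)%N by rewrite ltnNge; apply/negP => /noBD.
rewrite lee_fin ler_pdivrMr// mulrAC ler_pdivlMr// -!natrM ler_nat.
by rewrite !mulnDr (mulnC k g.+1) leq_add2r leq_pmul2r.
Qed.
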